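(* Let $\mathcal{I}$ be an instance with class formula $\Delta$. The set of all shortest flips to the decision on $\mathcal{I}$ is exactly the set of all instances $\mathcal{I}'$ such that $\mathcal{I}'$ is a $\sigma$-violation of $\mathcal{I}$ for some shortest general necessary reason (GNR) $\sigma$ for the decision on $\mathcal{I}$.
   Context: There is a finite set of variables, each variable $X$ having a finite set of at least two states. An $X$-literal is a nonempty proper subset of the states of $X$ (true when the state of $X$ lies in it); it is simple if it is a singleton. A clause is a disjunction of literals, written with at most one literal per variable. An NNF is a formula built from literals and constants with $\wedge,\vee$ only. $\mathrm{vars}(\cdot)$ is the set of variables occurring in a formula. An implicate of a formula is a (non-valid) clause implied by it; it is prime if no other implicate implies it. An instance $\mathcal{I}$ is a conjunction of one simple literal for each variable; its class formula $\Delta$ is a formula with $\mathcal{I}\models\Delta$ encoding the instances in the class of $\mathcal{I}$. The general reason for the decision on $\mathcal{I}$ is (up to equivalence) the weakest NNF that implies $\Delta$ and all of whose literals are implied by $\mathcal{I}$. A GNR for the decision is a prime implicate $\sigma$ of the general reason that is variable-minimal: no prime implicate $\sigma'$ of the general reason has $\mathrm{vars}(\sigma')\subsetneq\mathrm{vars}(\sigma)$. A GNR $\sigma$ is shortest if no GNR $\sigma'$ has $|\mathrm{vars}(\sigma')|<|\mathrm{vars}(\sigma)|$. For instances $\mathcal{I},\mathcal{I}'$, $\mathrm{Dvars}(\mathcal{I},\mathcal{I}')$ is the set of variables on which they disagree. For a clause $\sigma$ with $\mathcal{I}\models\sigma$, an instance $\mathcal{I}'$ is a $\sigma$-violation of $\mathcal{I}$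 if $\mathrm{vars}(\sigma)=\mathrm{Dvars}(\mathcal{I},\mathcal{I}')$ and $\mathcal{I}'\not\models\sigma$. An instance $\mathcal{I}'$ is a shortest flip to the decision on $\mathcal{I}$ if $\mathcal{I}'\not\models\Delta$ and no instance $\mathcal{I}''$ satisfies $\mathcal{I}''\not\models\Delta$ and $|\mathrm{Dvars}(\mathcal{I},\mathcal{I}'')|<|\mathrm{Dvars}(\mathcal{I},\mathcal{I}')|$. *)

(* Defs.v *)
From mathcomp Require Import all_boot.

Set Implicit Arguments.
Unset Strict Implicit.
Unset Printing Implicit Defensive.

Section Formulas.

Variables (V : finType) (St : V -> finType).

Definition literal : Type :=
  {l : {X : V & {set St X}} | (tagged l != set0) && (tagged l != [set: St (tag l)])}.

Definition lit_var (l : literal) : V := tag (val l).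
Definition lit_states (l : literal) : {set St (lit_var l)} := tagged (val l).

(* An instance is identified with the assignment of states that it describes:
   the conjunction of the simple literals {I X} has I as its only model, so
   that "I implies phi" is "phi is true at I". *)
Definition instance : Type := {dffun forall X : V, St X}.

Definition lit_true (w : instance) (l : literal) : bool :=
  w (lit_var l) \in lit_states l.

Inductive formula : Type :=
  | FTrue
  | FFalse
  | FLit of literal
  | FNot of formula
  | FAnd of formula & formula
  | FOr of formula & formula.

Fixpoint sat (w : instance) (f : formula) : bool :=
  match f with
  | FTrue => true
  | FFalse => false
  | FLit l => lit_true w l
  | FNot g => ~~ sat w g
  | FAnd g h => sat w g && sat w h
  | FOr g h => sat w g || sat w h
  end.

Definition entails (f g : formula) : Prop := forall w, sat w f -> sat w g.

Fixpoint is_nnf (f : formula) : bool :=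
  match f with
  | FNot _ => false
  | FAnd g h | FOr g h => is_nnf g && is_nnf h
  | _ => true
  end.

Fixpoint lits (f : formula) : {set literal} :=
  match f with
  | FTrue | FFalse => set0
  | FLit l => [set l]
  | FNot g => lits g
  | FAnd g h | FOr g h => lits g :|: lits h
  end.

(* A clause is the set of its disjuncts, so that clauses differing only in the
   order or repetition of literals are the same clause; this is what gives
   "other implicate" its meaning in [prime_implicate]. *)
Definition is_clause (s : {set literal}) : Prop := {in s &, injective lit_var}.

Definition clause_true (w : instance) (s : {set literal}) : bool :=
  [exists l in s, lit_true w l].

Definition clause_vars (s : {set literal}) : {set V} := lit_var @: s.

Definition implicate (f : formula) (s : {set literal}) : Prop :=
  [/\ is_clause s,
      ~ (forall w, clause_true w s)
    & forall w, sat w f -> clause_true w s].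

Definition prime_implicate (f : formula) (s : {set literal}) : Prop :=
  implicate f s /\
  forall s', implicate f s' -> s' <> s ->
    ~ (forall w, clause_true w s' -> clause_true w s).

Definition reason_candidate (I : instance) (D G : formula) : Prop :=
  [/\ is_nnf G, entails G D & forall l, l \in lits G -> lit_true I l].

Definition general_reason (I : instance) (D G : formula) : Prop :=
  reason_candidate I D G /\
  forall G', reason_candidate I D G' -> entails G' G.

(* General reasons are unique up to equivalence and [prime_implicate] only
   depends on the models of its formula, so the choice of G is immaterial. *)
Definition GNR (I : instance) (D : formula) (s : {set literal}) : Prop :=
  exists G, [/\ general_reason I D G,
                prime_implicate G s
              & forall s', prime_implicate G s' ->
                  ~~ (clause_vars s' \proper clause_vars s)].

Definition shortest_GNR (I : instance) (D : formula) (s : {set literal}) : Prop :=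
  GNR I D s /\
  forall s', GNR I D s' -> ~~ (#|clause_vars s'| < #|clause_vars s|).

Definition Dvars (I I' : instance) : {set V} := [set X | I X != I' X].

Definition violation (I : instance) (s : {set literal}) (I' : instance) : Prop :=
  [/\ clause_true I s, clause_vars s = Dvars I I' & ~~ clause_true I' s].

Definition shortest_flip (I : instance) (D : formula) (I' : instance) : Prop :=
  ~~ sat I' D /\
  forall I'', ~~ sat I'' D -> ~~ (#|Dvars I I''| < #|Dvars I I'|).

End Formulas.

(* Main.v *)
(** The general reason holds at a world [w] exactly when every world obtained
    from [w] by resetting some variables to their states in [I] satisfies
    [Delta].  Hence a falsifying world of an implicate [s], reset to [I] outside
    [vars(s)], can be reset further to a flip that differs from [I] only inside
    [vars(s)]; conversely the clause excluding exactly the states in which a flip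
    differs from [I] is an implicate.  So the minimum number of variables in an
    implicate equals the minimum size of a flip. *)
Require Import Defs.
From mathcomp Require Import all_boot.

Section Reasons.

Variables (V : finType) (St : V -> finType).
Implicit Types (I w : instance St) (D G f : formula St).
Implicit Types (s : {set literal St}) (l : literal St).

(** * Literals and entailment between clauses *)

Lemma literal_eq {l1 l2} (e : lit_var l1 = lit_var l2) :
  (forall w, lit_true w l1 = lit_true w l2) -> instance St -> l1 = l2.
Proof.
case: l1 e => -[X1 S1] p1; case: l2 => -[X2 S2] p2; rewrite /lit_var /=.
move=> e; subst X2; rewrite /lit_true /lit_states /lit_var /= => E w.
suff e : S1 = S2 by subst S2; apply: val_inj.
apply/setP => a; have := E (finfun (dfwith w a)).
by rewrite !ffunE dfwith_in.
Qed.

Lemma clause_trueP w s :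
  reflect (exists2 l, l \in s & lit_true w l) (clause_true w s).
Proof. exact: exists_inP. Qed.

Lemma eq_clause_true {w w' s} :
  {in clause_vars s, forall X, w X = w' X} -> clause_true w s = clause_true w' s.
Proof.
move=> E; apply: eq_existsb => l; case: (boolP (l \in s)) => //= ls.
by rewrite /lit_true E // imset_f.
Qed.

(* Change a falsifying world of [s'] in the single variable of [l]: the clause
   [s'] can then only become true through a literal on that variable. *)
Lemma clause_entails_literal {s s' l} :
  is_clause s' -> ~ (forall w, clause_true w s') ->
  (forall w, clause_true w s -> clause_true w s') -> l \in s ->
  exists l', [/\ l' \in s', lit_var l' = lit_var l
               & forall w, lit_true w l -> lit_true w l'].
Proof.
move=> cs' /forallP; rewrite negb_forall => /existsP[w0 w0F] E ls.
have step (w : instance St) : lit_true w l ->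
    exists l', [/\ l' \in s', lit_var l' = lit_var l & lit_true w l'].
  move=> wl; pose w1 : instance St := finfun (dfwith w0 (w (lit_var l))).
  have w1l : lit_true w1 l by rewrite /lit_true ffunE dfwith_in.
  have /E/clause_trueP[l' l's w1l'] : clause_true w1 s.
    by apply/clause_trueP; exists l.
  have [e|ne] := eqVneq (lit_var l) (lit_var l').
    exists l'; split=> //; move: w1l'; rewrite /lit_true ffunE.
    by move: (lit_states l'); rewrite -e => S; rewrite dfwith_in.
  case/negP: w0F; apply/clause_trueP; exists l' => //.
  by move: w1l'; rewrite /lit_true ffunE dfwith_out.
(* The literal given by [step] may depend on the world. One of them is fixed here; since [s'] has at
   most one literal per variable, every other choice coincides with it. *)
have [a al] : exists a, a \in lit_states l.
  by apply/set0Pn; case/andP: (valP l).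
pose w1 : instance St := finfun (dfwith w0 a).
have [|l' [l's e _]] := step w1; first by rewrite /lit_true ffunE dfwith_in.
exists l'; split=> // w /step[l2 [l2s e2 wl2]].
by rewrite (cs' l' l2) // e e2.
Qed.

Lemma clause_vars_entails {s s'} :
  is_clause s' -> ~ (forall w, clause_true w s') ->
  (forall w, clause_true w s -> clause_true w s') ->
  clause_vars s \subset clause_vars s'.
Proof.
move=> cs' nv E; apply/subsetP => X /imsetP[l ls ->].
by have [l' [l's <- _]] := clause_entails_literal cs' nv E ls; apply: imset_f.
Qed.

(** Passing from a literal of [s] to a weaker one of [s'] and back stays on the same variable, hence
    returns to the starting literal, so both have the same models. *)
Lemma equivalent_clauses_eq s s' :
  is_clause s -> ~ (forall w, clause_true w s) ->
  is_clause s' -> ~ (forall w, clause_true w s') ->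
  (forall w, clause_true w s = clause_true w s') -> s = s'.
Proof.
wlog suff sub : s s' / is_clause s -> ~ (forall w, clause_true w s) ->
    is_clause s' -> ~ (forall w, clause_true w s') ->
    (forall w, clause_true w s = clause_true w s') -> s \subset s'.
  by move=> c n c' n' E; apply/eqP; rewrite eqEsubset !sub.
move=> c n c' n' E; apply/subsetP => l ls.
have E1 w : clause_true w s -> clause_true w s' by rewrite E.
have E2 w : clause_true w s' -> clause_true w s by rewrite E.
have [l' [l's e' L1]] := clause_entails_literal c' n' E1 ls.
have [l2 [l2s e2 L2]] := clause_entails_literal c n E2 l's.
have El : l2 = l by apply: c => //; rewrite e2.
(* Non-validity of [s] is used only to obtain the instance that [literal_eq] asks for. *)
move: n => /forallP; rewrite negb_forall => /existsP[w0 _].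
rewrite (@literal_eq l l') // => w; apply/idP/idP; first exact: L1.
by move=> /L2; rewrite El.
Qed.

(** * Existence of prime implicates *)

Definition implicateb f s :=
  [&& dinjectiveb (@lit_var V St) [in s], [exists w, ~~ clause_true w s]
    & [forall w, sat w f ==> clause_true w s]].

Lemma implicateP f s : reflect (implicate f s) (implicateb f s).
Proof.
apply: (iffP and3P) => -[c n i]; split.
- exact/dinjectiveP.
- by move=> v; case/existsP: n => w; rewrite v.
- by move=> w; apply/implyP/(forallP i).
- exact/dinjectiveP.
- by rewrite -negb_forall; apply/forallP.
- by apply/forallP => w; apply/implyP/i.
Qed.

(** Among the implicates that entail [s], one with the fewest models is prime: an implicate
    entailing it has the same models, and so is the same set of literals. *)
Lemma prime_implicate_below {f s} : implicate f s ->
  exists s', prime_implicate f s' /\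
    forall w, clause_true w s' -> clause_true w s.
Proof.
move=> /implicateP is_s.
pose P s' := implicateb f s' &&
  ([set w | clause_true w s'] \subset [set w | clause_true w s]).
have Ps : P s by rewrite /P is_s subxx.
case: (arg_minnP (fun s' => #|[set w | clause_true w s']|) Ps) => m.
case/andP=> /implicateP im sub min; exists m; split; last first.
  by move=> w wm; have /subsetP/(_ w) := sub; rewrite !inE; apply.
split=> // s' is' ne E; apply: ne.
have sub' : [set w | clause_true w s'] \subset [set w | clause_true w m].
  by apply/subsetP => w; rewrite !inE; apply: E.
have Ps' : P s' by rewrite /P (subset_trans sub' sub) andbT; apply/implicateP.
have /eqP eq' : [set w | clause_true w s'] == [set w | clause_true w m].
  by rewrite eqEcard sub' min.
have [cm nm _] := im; have [c' n' _] := is'.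
by apply: equivalent_clauses_eq => // w; move/setP/(_ w): eq'; rewrite !inE.
Qed.

(** * Resetting variables to their states in [I] *)

Definition toward I w w' := [forall X, (w' X == w X) || (w' X == I X)].

Definition robust I D w := [forall w', toward I w w' ==> sat w' D].

Lemma toward_refl I w : toward I w w.
Proof. by apply/forallP => X; rewrite eqxx. Qed.

Lemma Dvars_toward {I w w'} : toward I w w' -> Dvars I w' \subset Dvars I w.
Proof.
move=> /forallP t; apply/subsetP => X; rewrite !inE.
by case/orP: (t X) => /eqP->; rewrite ?eqxx.
Qed.

Lemma toward_Dvars_eq {I w w'} :
  toward I w w' -> Dvars I w' = Dvars I w -> w' = w.
Proof.
move=> /forallP t e; apply/ffunP => X; case/orP: (t X) => /eqP // eX.
by move/setP/(_ X): e; rewrite !inE eX eqxx => /esym/negbFE/eqP.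
Qed.

(** A literal true at [I] cannot become false by resetting its variable to [I], and an NNF is
    monotone in its literals. *)
Lemma sat_toward {I G w w'} :
  is_nnf G -> (forall l, l \in lits G -> lit_true I l) ->
  toward I w w' -> sat w G -> sat w' G.
Proof.
move=> nnf L /forallP t; elim: G nnf L => //= [l|g IHg h IHh|g IHg h IHh].
- move=> _ /(_ l); rewrite inE eqxx => /(_ isT).
  by rewrite /lit_true; case/orP: (t (lit_var l)) => /eqP->.
- case/andP=> ng nh L /andP[wg wh]; apply/andP; split.
    by apply: IHg => // l lg; apply: L; rewrite inE lg.
  by apply: IHh => // l lg; apply: L; rewrite inE lg orbT.
- case/andP=> ng nh L /orP[wg|wh]; apply/orP; [left|right].
    by apply: IHg => // l lg; apply: L; rewrite inE lg.
  by apply: IHh => // l lg; apply: L; rewrite inE lg orbT.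
Qed.

(** * An explicit general reason *)

(** The default [FTrue] is right for the set of all states, which is not a literal; this occurs in
    [cube] when [w X] and [I X] exhaust [St X]. It is wrong for the empty set. *)
Definition state_formula {X : V} (S : {set St X}) : formula St :=
  if insub (Tagged (fun X => {set St X}) S) is Some l then FLit l
  else FTrue St.

Lemma sat_state_formula w X (S : {set St X}) :
  S != set0 -> sat w (state_formula S) = (w X \in S).
Proof.
move=> S0; rewrite /state_formula; case: insubP => [l _ e|].
  by rewrite -[sat _ _]/(lit_true w l) /lit_true /lit_states /lit_var e.
by rewrite /= S0 negbK => /eqP->; rewrite inE.
Qed.

Lemma lits_state_formula I X (S : {set St X}) l :
  I X \in S -> l \in lits (state_formula S) -> lit_true I l.
Proof.
rewrite /state_formula; case: insubP => [l' _ e IS|_ _]; last by rewrite inE.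
by rewrite inE => /eqP->; rewrite /lit_true /lit_states /lit_var e.
Qed.

(* The models of this term are the worlds obtained from [w] by resetting some
   variables to their states in [I]. *)
Definition cube I w : formula St :=
  foldr (fun X => FAnd (state_formula [set w X; I X])) (FTrue St) (enum V).

Definition robust_formula I D : formula St :=
  foldr (fun w => FOr (cube I w)) (FFalse St) (enum (robust I D)).

Lemma sat_cube I w w' : sat w' (cube I w) = toward I w w'.
Proof.
have -> : sat w' (cube I w) =
    all (fun X => (w' X == w X) || (w' X == I X)) (enum V).
  rewrite /cube; elim: (enum V) => //= X r ->.
  rewrite sat_state_formula ?inE //.
  by apply/set0Pn; exists (w X); rewrite !inE eqxx.
apply/allP/forallP => [h X|h X _]; last exact: h.
by apply: h; rewrite mem_enum.
Qed.

Lemma sat_robust_formula I D w :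
  sat w (robust_formula I D) = [exists w0 in robust I D, toward I w0 w].
Proof.
have -> : sat w (robust_formula I D) =
    has (fun w0 => toward I w0 w) (enum (robust I D)).
  by rewrite /robust_formula; elim: (enum _) => //= w0 r ->; rewrite sat_cube.
apply/hasP/exists_inP => -[w0]; first by rewrite mem_enum; exists w0.
by move=> r t; exists w0 => //; rewrite mem_enum.
Qed.

Lemma robust_formula_nnf I D : is_nnf (robust_formula I D).
Proof.
rewrite /robust_formula; elim: (enum _) => //= w r ->; rewrite andbT /cube.
elim: (enum V) => //= X r' ->; rewrite andbT /state_formula.
by case: insubP.
Qed.

Lemma robust_formula_lits I D l :
  l \in lits (robust_formula I D) -> lit_true I l.
Proof.
rewrite /robust_formula; elim: (enum _) => [|w r IH] /=; first by rewrite inE.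
rewrite inE => /orP[|/IH //]; rewrite /cube.
elim: (enum V) => [|X r' IH'] /=; first by rewrite inE.
rewrite inE => /orP[|/IH' //]; apply: lits_state_formula.
by rewrite !inE eqxx orbT.
Qed.

Lemma robust_formula_candidate I D : reason_candidate I D (robust_formula I D).
Proof.
split; [exact: robust_formula_nnf| |exact: robust_formula_lits].
move=> w; rewrite sat_robust_formula => /exists_inP[w0 /forallP r t].
by have := r w; rewrite t.
Qed.

Lemma candidate_robust {I D G w} :
  reason_candidate I D G -> sat w G -> robust I D w.
Proof.
case=> nnf E L wG; apply/forallP => w'; apply/implyP => t; apply: E.
exact: sat_toward t wG.
Qed.

Lemma robust_general_reason I D : general_reason I D (robust_formula I D).
Proof.
split; first exact: robust_formula_candidate.
move=> G cG w wG; rewrite sat_robust_formula; apply/exists_inP.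
by exists w; [exact: candidate_robust cG wG|exact: toward_refl].
Qed.

Lemma sat_general_reason {I D G} w :
  general_reason I D G -> sat w G = robust I D w.
Proof.
case=> cG max; apply/idP/idP; first exact: candidate_robust.
move=> r; apply: (max _ (robust_formula_candidate I D)).
by rewrite sat_robust_formula; apply/exists_inP; exists w; rewrite ?toward_refl.
Qed.

(** * Implicates of the general reason and flips *)

(** Besides the bound on [Dvars], the relation [toward I w w'] is kept: it later forces [w' = w]
    when both differ from [I] on the same variables. *)
Lemma falsified_implicate_flip {I D G s w} :
  general_reason I D G -> implicate G s -> ~~ clause_true w s ->
  exists2 w', ~~ sat w' D & toward I w w' /\ Dvars I w' \subset clause_vars s.
Proof.
move=> gr [_ _ i] wF.
pose w1 : instance St := [ffun X => if X \in clause_vars s then w X else I X].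
have w1F : ~~ clause_true w1 s.
  by rewrite (@eq_clause_true _ w s) // => X Xs; rewrite ffunE Xs.
have : ~~ robust I D w1.
  by rewrite -(sat_general_reason _ gr); apply: contra w1F; apply: i.
rewrite negb_forall => /existsP[w']; rewrite negb_imply => /andP[t w'D].
exists w' => //; split.
  apply/forallP => X; have /forallP/(_ X) := t; rewrite ffunE.
  by case: ifP => // _ /orP[] ->; rewrite orbT.
apply: subset_trans (Dvars_toward t) _; apply/subsetP => X.
by rewrite inE ffunE; case: ifP => //; rewrite eqxx.
Qed.

Lemma implicate_flip {I D G s} :
  general_reason I D G -> implicate G s ->
  exists2 w, ~~ sat w D & Dvars I w \subset clause_vars s.
Proof.
move=> gr im; have [_ /forallP n _] := im.
move: n; rewrite negb_forall => /existsP[w wF].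
by have [w' ? []] := falsified_implicate_flip gr im wF; exists w'.
Qed.

Definition flip_clause I w : {set literal St} :=
  [set l | (lit_var l \in Dvars I w) &&
           (lit_states l == ~: [set w (lit_var l)])].

Lemma flip_clause_false I w w' :
  (~~ clause_true w' (flip_clause I w)) =
  [forall X in Dvars I w, w' X == w X].
Proof.
apply/idP/forall_inP => [F X Xd|E].
  apply: contraR F => ne; apply/clause_trueP.
  (* The complement contains [w' X] and omits [w X], so it is a legitimate literal. *)
  have p : (~: [set w X] != set0) && (~: [set w X] != [set: St X]).
    apply/andP; split.
      by apply/set0Pn; exists (w' X); rewrite !inE.
    by apply/eqP => /setP/(_ (w X)); rewrite !inE eqxx.
  exists (Sub (Tagged (fun X => {set St X}) (~: [set w X])) p : literal St).
    by rewrite inE /lit_states /lit_var /= Xd eqxx.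
  by rewrite /lit_true /lit_states /lit_var /= !inE.
apply/clause_trueP => -[l]; rewrite inE => /andP[ld /eqP el].
by rewrite /lit_true el !inE E.
Qed.

(** A world falsifying the clause agrees with [w] on [Dvars I w]; resetting its other variables
    gives [w], which falsifies [D], so that world is not robust. *)
Lemma flip_clause_implicate {I D G w} :
  general_reason I D G -> ~~ sat w D -> implicate G (flip_clause I w).
Proof.
move=> gr wD; split.
- move=> l1 l2; rewrite !inE => /andP[_ /eqP e1] /andP[_ /eqP e2] e.
  apply: (literal_eq e) => // w'.
  by rewrite /lit_true e1 e2 e.
- move=> /(_ w); apply/negP; rewrite flip_clause_false.
  by apply/forall_inP.
- move=> w'; rewrite (sat_general_reason _ gr) => /forallP/(_ w).
  apply: contraTT; rewrite flip_clause_false => /forall_inP E.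
  rewrite (negbTE wD) implybF negbK; apply/forallP => X.
  have := E X; rewrite inE; case: eqVneq => [_ _|_ /(_ isT)/eqP->].
    by rewrite orbT.
  by rewrite eqxx.
Qed.

Lemma clause_vars_flip_clause I w :
  clause_vars (flip_clause I w) \subset Dvars I w.
Proof. by apply/subsetP => X /imsetP[l]; rewrite inE => /andP[? _] ->. Qed.

Lemma shortest_flip_implicate {I D G w s} :
  general_reason I D G -> shortest_flip I D w -> implicate G s ->
  #|Dvars I w| <= #|clause_vars s|.
Proof.
move=> gr [_ min] /(implicate_flip gr)[w' w'D sub].
by apply: leq_trans (subset_leq_card sub); rewrite leqNgt min.
Qed.

(** * Shortest flips and shortest GNRs *)

(** A prime implicate below the flip clause has its variables inside [Dvars I w] and, by minimality
    of the flip, no fewer of them. Minimal cardinality then gives both variable-minimality and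
    shortestness. *)
Lemma shortest_flip_GNR {I D w} : sat I D -> shortest_flip I D w ->
  exists s, shortest_GNR I D s /\ violation I s w.
Proof.
move=> ID fw; have [wD min] := fw; have gr := robust_general_reason I D.
have imw := flip_clause_implicate gr wD.
have [s [ps E]] := prime_implicate_below imw; have [ims _] := ps.
have [cw nw _] := imw.
have sub := subset_trans (clause_vars_entails cw nw E)
  (clause_vars_flip_clause I w).
have /eqP es : clause_vars s == Dvars I w.
  by rewrite eqEcard sub (shortest_flip_implicate gr fw ims).
exists s; split; last first.
  split=> //.
    (* [I] is robust, as its only reset is itself, so it satisfies every implicate. *)
    have [_ _] := ims; apply; rewrite (sat_general_reason _ gr).
    apply/forallP => w'; apply/implyP => /forallP t.
    suff -> : w' = I by [].
    by apply/ffunP => X; case/orP: (t X) => /eqP.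
  apply/negP => /E; apply/negP; rewrite flip_clause_false.
  by apply/forall_inP.
split.
  exists (robust_formula I D); split=> // s' [ims' _].
  apply/negP => /proper_card; apply/negP; rewrite -leqNgt es.
  exact: (shortest_flip_implicate gr fw ims').
move=> s' [G' [gr' [ims' _] _]]; rewrite -leqNgt es.
exact: (shortest_flip_implicate gr' fw ims').
Qed.

Lemma shortest_flip_exists {I D w} : ~~ sat w D ->
  exists w', shortest_flip I D w'.
Proof.
move=> wD; case: (@arg_minnP _ w (fun w => ~~ sat w D)
  (fun w => #|Dvars I w|) wD) => m mD min.
by exists m; split=> // w' w'D; rewrite -leqNgt min.
Qed.

(** Resetting [w] yields a flip [w'] with [Dvars I w'] inside [Dvars I w]. The GNR of a shortest
    flip [m] has as many variables as [m] has disagreements, so shortestness of [s] bounds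
    [Dvars I w] by [Dvars I m] in size. Hence nothing was reset and [w] itself is a flip. *)
Lemma violation_shortest_flip {I D s w} : sat I D ->
  shortest_GNR I D s -> violation I s w -> shortest_flip I D w.
Proof.
move=> ID [[G [gr [ims _] _]] min] [_ es wF].
have [w' w'D [t _]] := falsified_implicate_flip gr ims wF.
have [m fm] := shortest_flip_exists (I := I) w'D.
have [sm [/proj1 /min le [_ em _]]] := shortest_flip_GNR ID fm.
rewrite -leqNgt es em in le.
have [mD minm] := fm.
have le' : #|Dvars I w| <= #|Dvars I w'|.
  by apply: leq_trans le _; rewrite leqNgt minm.
have /eqP ed : Dvars I w' == Dvars I w by rewrite eqEcard Dvars_toward.
have ew := toward_Dvars_eq t ed; subst w'.
split=> // w2 w2D; rewrite -leqNgt; apply: leq_trans le _.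
by rewrite leqNgt minm.
Qed.

End Reasons.

Theorem mainTheorem5 (V : finType) (St : V -> finType)
    (hS : forall X : V, 1 < #|St X|)
    (I : instance St) (Delta : formula St) (hI : sat I Delta) :
  forall I' : instance St,
    shortest_flip I Delta I' <->
    exists sigma : {set literal St},
      shortest_GNR I Delta sigma /\ violation I sigma I'.
Proof.
move=> I'; split; first exact: shortest_flip_GNR.
by case=> s [gs vs]; apply: violation_shortest_flip gs vs.
Qed.
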